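(* Let $G=(V,E)$ be a connected graph. Then $G$ is bipartite if and only if $\theta=\Theta$, where $\theta$ and $\Theta$ are Djokovi\'c's and Winkler's relations on the edge set $E$.
   Context: Graphs are simple, undirected, nonempty, and not necessarily finite; $d$ denotes the shortest-path distance in $G$. For adjacent vertices $a,b\in V$ put $W_{ab}=\{w\in V: d(w,a)<d(w,b)\}$. Djokovi\'c's relation $\theta$ on $E$: for edges $e=xy$ and $f$, $e\,\theta\, f$ if and only if $f$ joins a vertex in $W_{xy}$ with a vertex in $W_{yx}$. Winkler's relation $\Theta$ on $E$: for edges $e=xy$ and $f=uv$, $e\,\Theta\, f$ if and only if $d(x,u)+d(y,v)\neq d(x,v)+d(y,u)$. *)

(* Defs.v *)
From mathcomp Require Import all_boot.
From mathcomp Require Import boolp classical_sets.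

Set Implicit Arguments.
Unset Strict Implicit.
Unset Printing Implicit Defensive.

Local Open Scope classical_set_scope.

(* The vertex type is arbitrary, so graphs may be infinite.  Classically every
   Prop-valued relation is decidable, so a boolean adjacency is no loss. *)
Record sgraph (V : Type) := SGraph {
  adj : rel V;
  adj_sym : symmetric adj;
  adj_irrefl : irreflexive adj;
  vertex_inhabited : inhabited V
}.

Section Graph.
Variables (V : Type) (G : sgraph V).

Definition walk_between (x y : V) (p : seq V) : Prop :=
  path (adj G) x p /\ last x p = y.

Definition connected_graph : Prop :=
  forall x y, exists p, walk_between x y p.

Definition walk_length (x y : V) : pred nat :=
  fun n => `[< exists2 p, walk_between x y p & size p = n >].

(* A walk of minimal length repeats no vertex, so this is the length of a
   shortest path; the value 0 for vertices in different components is junk. *)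
Definition dist (x y : V) : nat :=
  if pselect (exists n, walk_length x y n) is left h then ex_minn h else 0.

Definition W (a b : V) : set V := [set w | dist w a < dist w b].

Definition edge : Type :=
  {e : set V | exists x y, adj G x y /\ e = [set x; y]}.

Definition joins (e : edge) (x y : V) : Prop := sval e = [set x; y].

(* In the next two definitions the choice of names for the two ends of an edge
   is immaterial: see djokovicE and winklerE below. *)
Definition djokovic (e f : edge) : Prop :=
  exists x y, joins e x y /\
    exists u v, [/\ joins f u v, W x y u & W y x v].

Definition winkler (e f : edge) : Prop :=
  exists x y u v, [/\ joins e x y, joins f u v &
    dist x u + dist y v <> dist x v + dist y u].

(* A part may be empty, so that the one-vertex graph is bipartite. *)
Definition bipartite : Prop :=
  exists A B : set V, [/\ A `|` B = setT, A `&` B = set0 &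
    forall x y, adj G x y -> (A x /\ B y) \/ (B x /\ A y)].

Lemma joinsC (e : edge) x y : joins e x y -> joins e y x.
Proof. by rewrite /joins setUC. Qed.

Lemma joins_ends (e : edge) x y x' y' : joins e x y -> joins e x' y' ->
  (x = x' /\ y = y') \/ (x = y' /\ y = x').
Proof.
rewrite /joins => -> E.
have : [set x'; y'] x by rewrite -E; left.
have : [set x'; y'] y by rewrite -E; right.
have : [set x; y] x' by rewrite E; left.
have : [set x; y] y' by rewrite E; right.
move=> [] /= ? [] /= ? [] /= ? [] /= ?; subst; auto.
Qed.

Lemma joins_adj (e : edge) x y : joins e x y -> adj G x y.
Proof.
case: (svalP e) => a [b [ab eE]] /joins_ends /(_ eE) [] [-> ->] //.
by rewrite adj_sym.
Qed.

Lemma djokovicE (e f : edge) x y : joins e x y ->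
  djokovic e f <-> exists u v, [/\ joins f u v, W x y u & W y x v].
Proof.
move=> exy; split=> [[x' [y' [exy' [u [v [fuv Wu Wv]]]]]]|H]; last by exists x, y.
have [[-> ->]|[-> ->]] := joins_ends exy exy'; first by exists u, v.
by exists v, u; split=> //; exact: joinsC.
Qed.

Lemma winklerE (e f : edge) x y u v : joins e x y -> joins f u v ->
  winkler e f <-> dist x u + dist y v <> dist x v + dist y u.
Proof.
move=> exy fuv; split=> [[x' [y' [u' [v' [exy' fuv' H]]]]]|H].
  have [[-> ->]|[-> ->]] := joins_ends exy exy';
  have [[-> ->]|[-> ->]] := joins_ends fuv fuv' => K; apply: H.
  - exact: K.
  - exact: esym.
  - by rewrite addnC -K addnC.
  - by rewrite addnC K addnC.
by exists x, y, u, v.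
Qed.

End Graph.

(* Main.v *)
Require Import Defs.
From mathcomp Require Import all_boot.
From mathcomp Require Import boolp classical_sets zify.

(** In a connected graph both conditions are equivalent to: no edge has its
    two ends equidistant from a vertex.  If this holds, then for adjacent [x],
    [y] the difference [d(x,w) - d(y,w)] is always 1 or -1, so the ends of an
    edge give different values exactly when they lie on opposite sides.
    Conversely, if [d(w,u) = d(w,v) = k] with [uv] an edge and [k] minimal, let
    [w'] be a neighbour of [w] closer to [u]; minimality gives [d(w',v) = k],
    so [uv] and [ww'] are in relation [Theta], but not in relation [theta]
    because [w] is on neither side of [uv]. *)

Section Distance.
Variables (V : Type) (G : sgraph V).
Hypothesis connG : connected_graph G.
Local Notation d := (dist G).

Lemma dist_walk x y : exists2 p, walk_between G x y p & size p = d x y.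
Proof.
rewrite /dist; case: pselect => [ex_n|[]]; last first.
  by have [p pxy] := connG x y; exists (size p); apply/asboolP; exists p.
by case: ex_minnP => n /asboolP.
Qed.

Lemma dist_min x y p : walk_between G x y p -> d x y <= size p.
Proof.
move=> pxy; rewrite /dist; case: pselect => // ex_n.
by case: ex_minnP => n _; apply; apply/asboolP; exists p.
Qed.

Lemma distC x y : d x y = d y x.
Proof.
suff le_d a b : d a b <= d b a by apply/eqP; rewrite eqn_leq !le_d.
have [p [pP lp] <-] := dist_walk b a.
(* Read backwards, the walk [b :: p] starts at [a = last b p] and continues with
   [rev (belast b p)]. *)
rewrite -(size_belast b p) -size_rev; apply: dist_min; split.
  by rewrite -lp rev_path (@eq_path _ _ (adj G)) // => u v; rewrite adj_sym.
by case: p pP lp => [|c p] //= _ _; rewrite rev_cons last_rcons.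
Qed.

Lemma dist_eq0 x y : d x y = 0 -> x = y.
Proof. by have [[|a p] [_ /= <-] <-] := dist_walk x y. Qed.

Lemma dist_adjr w u v : adj G u v -> d w v <= (d w u).+1.
Proof.
move=> uv; have [p [pP lp] <-] := dist_walk w u.
rewrite -(size_rcons p v); apply: dist_min; split; last by rewrite last_rcons.
by rewrite rcons_path pP lp.
Qed.

Lemma dist_adjl u v w : adj G u v -> d v w <= (d u w).+1.
Proof. by move=> uv; rewrite !(distC _ w) dist_adjr. Qed.

Lemma dist_pred w u k :
  d w u = k.+1 -> exists2 w', adj G w w' & d w' u = k.
Proof.
move=> wu; have [p] := dist_walk w u; rewrite wu.
case: p => [|w' p] [] //= /andP[ww' pP] lp [sp]; exists w' => //.
have : d w' u <= k by rewrite -sp; apply: dist_min.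
have : d w u <= (d w' u).+1 by apply: dist_adjl; rewrite adj_sym.
lia.
Qed.

Definition equidistant_free := forall w u v, adj G u v -> d w u <> d w v.

Lemma bipartiteP : bipartite G <-> equidistant_free.
Proof.
split=> [[A [B [AB AB0 adjAB]]] w u v uv|free].
  have nAB a : A a -> B a -> False.
    by move=> Aa Ba; have : set0 a by rewrite -AB0.
  pose c a := `[< A a >].
  have adj_c a b : adj G a b -> c b = ~~ c a.
    move=> /adjAB; rewrite /c => -[] [? ?].
      by rewrite (asboolT (P := A a)) // asboolF // => /nAB; apply.
    by rewrite (asboolT (P := A b)) // asboolF // => /nAB; apply.
  (* Every edge flips the colour, so the colours of the ends of a walk fix the parity of its length,
     in particular of the distance. *)
  have walk_c p a : path (adj G) a p -> c (last a p) = odd (size p) (+) c a.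
    elim: p a => [|b p IHp] a //= /andP[ab /IHp ->].
    by rewrite (adj_c _ _ ab) addbN addNb.
  have odd_d a : odd (d w a) = c a (+) c w.
    by have [p [/walk_c + <-] <-] := dist_walk w a => ->; rewrite addbK.
  by move/(congr1 odd); rewrite !odd_d (adj_c _ _ uv); case: (c u); case: (c w).
have [o] := vertex_inhabited G.
(* The parts are the parity classes of the distance from [o]: along an edge it changes by at most 1,
   and by [free] it does change. *)
exists [set a | odd (d o a)]%classic, [set a | ~~ odd (d o a)]%classic; split.
- by apply/seteqP; split=> a //= _; case: (odd _); [left|right].
- by apply/seteqP; split=> a //= [-> ].
move=> x y xy /=; have := free o x y xy.
have yx : adj G y x by rewrite adj_sym.
have := dist_adjr o x y xy; have := dist_adjr o y x yx; lia.
Qed.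

Lemma equidistant_freeP :
  equidistant_free <-> @djokovic V G = @winkler V G.
Proof.
split=> [free|eqDW].
  apply/funext=> e; apply/funext=> f; apply/propext.
  split=> [[x [y [exy [u [v [fuv Wu Wv]]]]]]|[x [y [u [v [exy fuv neq]]]]]].
    (* Adding the two strict inequalities shows that Winkler's two sums differ. *)
    by exists x, y, u, v; split=> //; move: Wu Wv; rewrite /W /= !(distC u, distC v); lia.
  have xy := joins_adj exy; have yx : adj G y x by rewrite adj_sym.
  have := free u x y xy; have := free v x y xy.
  have := dist_adjr u x y xy; have := dist_adjr u y x yx.
  have := dist_adjr v x y xy; have := dist_adjr v y x yx.
  rewrite !(distC x, distC y) in neq => le1 le2 le3 le4 ne1 ne2.
  exists x, y; split=> //.
  (* If [u] and [v] were on the same side of [xy], the differences of their distances to [x] and [y]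
     would agree, against [neq]. The side of [u] thus decides the order of the ends of [f]. *)
  have [lt_u|ge_u] := ltnP (d u x) (d u y).
    by exists u, v; split=> //; rewrite /W /=; lia.
  by exists v, u; split; rewrite /W /=; [exact: joinsC|lia|lia].
move=> w u v uv; move dk: (d w u) => k.
elim: k w dk => [|k IHk] w wu wv.
  (* At distance 0 both [u] and [v] equal [w], so [uv] would be a loop. *)
  move: uv; rewrite -(dist_eq0 _ _ wu) -(dist_eq0 _ _ (esym wv)).
  by rewrite adj_irrefl.
have [w' ww' w'u] := dist_pred _ _ _ wu.
have w'v : d w' v = k.+1.
  have := IHk w' w'u; have := dist_adjr w' u v uv.
  have := dist_adjl w' w v; rewrite adj_sym => /(_ ww'); lia.
pose e : edge G := exist _ _ (ex_intro _ u (ex_intro _ v (conj uv erefl))).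
pose f : edge G := exist _ _ (ex_intro _ w (ex_intro _ w' (conj ww' erefl))).
have euv : joins e u v by [].
have fww' : joins f w w' by [].
have : winkler e f.
  (* The two sums are [2k+2] and [2k+1]. *)
  by apply/(winklerE euv fww'); rewrite !(distC u, distC v); lia.
rewrite -eqDW => /(djokovicE f euv)[a [b [fab]]].
rewrite /W /=.
by have [[<- <-]|[<- <-]] := joins_ends fww' fab; lia.
Qed.

End Distance.

Theorem theorem3p2 (V : Type) (G : sgraph V) (hG : connected_graph G) :
  bipartite G <-> @djokovic V G = @winkler V G.
Proof. by rewrite bipartiteP // equidistant_freeP. Qed.
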